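(* Let $X$ be a separable metrizable space. If $X$ is indecomposable and connected, then the following are equivalent: (i) $\beta X$ is indecomposable; (ii) $X$ is strongly indecomposable; (iii) $X$ has a metrizable indecomposable compactification; (iv) $X$ has an indecomposable compactification; (v) $X$ has an irreducible compactification; (vi) $\beta X$ is irreducible.
   Context: $\beta X$ denotes the Stone-Čech compactification of $X$. A compactification of $X$ is a compact Hausdorff space in which $X$ is densely embedded. A topological space $Y$ is indecomposable if every connected subset of $Y$ is either dense or nowhere dense in $Y$; for a continuum (connected compact Hausdorff space) this is equivalent to not being the union of any two of its proper subcontinua. A topological space $X$ is strongly indecomposable if for every two non-empty disjoint open sets $U,V\subseteq X$ there are two closed sets $A,B\subseteq X$ such that $X=A\cup B$, $A\cap U\neq\varnothing$, $B\cap U\neq\varnothing$, and $A\cap B\subseteq V$. A composant of a continuum is the union of all its proper subcontinua that contain a given point. A continuum is irreducible if it has more than one composant, that is, if there are two points between which it is irreducible, meaning that no proper closed connected subset contains both points.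
   Formalization: X is assumed to have at least two distinct points; for a one-point (or empty) X the space βX is indecomposable but does not have more than one composant, so (i) holds while (vi) fails. *)

(* Defs.v *)
From mathcomp Require Import all_boot all_order all_algebra.
From mathcomp Require Import all_classical all_reals all_analysis.

Set Implicit Arguments.
Unset Strict Implicit.
Unset Printing Implicit Defensive.

Import Order.TTheory GRing.Theory Num.Theory.
Import numFieldTopology.Exports.

Local Open Scope classical_set_scope.
Local Open Scope ring_scope.

Definition nowhere_dense (T : topologicalType) (A : set T) : Prop :=
  interior (closure A) = set0.

Definition separable_space (T : topologicalType) : Prop :=
  exists2 D : set T, countable D & dense D.

Definition embedding (T U : topologicalType) (f : T -> U) : Prop :=
  injective f /\ @open T = @open (initial_topology f).

Definition metrizable (R : realType) (T : topologicalType) : Prop :=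
  exists (M : metricType R) (f : T -> M), embedding f /\ range f = [set: M].

Definition compactification (X K : topologicalType) (e : X -> K) : Prop :=
  [/\ compact [set: K], hausdorff_space K, embedding e & dense (range e)].

Definition unit_functions (R : realType) (X : topologicalType) :
    set (X -> R) :=
  [set f : X -> R | continuous f /\ forall x, 0 <= f x <= 1].

Definition cube (R : realType) (X : topologicalType) : topologicalType :=
  prod_topology (fun _ : @unit_functions R X => (R : topologicalType)).

Definition evaluation (R : realType) (X : topologicalType) (x : X) :
    cube R X :=
  fun f => set_val f x.

(* The closure is taken in a power of R, not of [0, 1]; this is the same set,
   since the power of [0, 1] is closed and contains the range. *)
Definition stone_cech (R : realType) (X : topologicalType) : topologicalType :=
  set_type (closure (range (@evaluation R X))).

Definition indecomposable (Y : topologicalType) : Prop :=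
  forall C : set Y, connected C -> dense C \/ nowhere_dense C.

Definition strongly_indecomposable (X : topologicalType) : Prop :=
  forall U V : set X, open U -> open V -> U !=set0 -> V !=set0 ->
    U `&` V = set0 ->
  exists A B : set X,
    [/\ closed A /\ closed B, A `|` B = [set: X], A `&` U !=set0,
        B `&` U !=set0 & A `&` B `<=` V].

Definition continuum (Y : topologicalType) : Prop :=
  [/\ compact [set: Y], hausdorff_space Y & connected [set: Y]].

(* In a compact Hausdorff space, the subcontinua are the closed connected
   subsets; those below contain [p]. *)
Definition composant (Y : topologicalType) (p : Y) : set Y :=
  \bigcup_(C in [set C : set Y |
    [/\ closed C, connected C, C <> [set: Y] & C p]]) C.

(* A one-point space has a single, empty, composant: it is not irreducible. *)
Definition irreducible (Y : topologicalType) : Prop :=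
  continuum Y /\ exists p q : Y, composant p <> composant q.

(* Main.v *)
From HB Require Import structures.
Require Import Defs.
From mathcomp Require Import all_boot all_order all_algebra.
From mathcomp Require Import all_classical all_reals all_analysis.

(** The implications are proved in a cycle; each indecomposability statement
    is used in the form: a proper closed connected subset has empty interior
    ([indecomposableP]).

    Indecomposable compactification to strong indecomposability
    ([compactification_strongly_indecomposable]). Let [U], [V] be disjoint and
    open in [K], and [W] a nonempty open set with closure inside [V]. A
    connected subset of [K \ W] containing [U] would be somewhere dense but not
    dense. In a compact Hausdorff space, the absence of such a connected set
    yields a partition of [K \ W] into two closed sets that both meet [U]
    ([closed_separation]: components are quasi-components). Adding the closure
    of [W] to both parts and intersecting with [X] gives the required cut.

    Strong indecomposability to a metrizable indecomposable compactification
    ([strongly_indecomposable_metrizable_compactification]). Fix a countable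
    base. For each disjoint pair of basic sets [U], [V], choose a cut [A], [B],
    and a Urysohn function separating the disjoint closed sets [A \ V] and
    [B \ V]. These countably many functions, with countably many more that
    determine the topology of [X], map [X] into a countable power of the real
    line, and [K] is the closure of the image. If a subcontinuum [C] of [K] is
    proper with nonempty interior, take [U] inside [C] and [V] away from [C]:
    then [C] is covered by the closures of [A \ V] and [B \ V], which are
    disjoint because their Urysohn function extends to [K], and [C] meets both
    since it contains [U].

    Indecomposable to irreducible compactification. An indecomposable continuum
    may have a single composant, but in one with a countable base each composant
    is a countable union of proper subcontinua, which are closed with empty
    interior, so it is not everything by the Baire category theorem
    ([countable_base_irreducible]). Hence the given compactification is first
    exchanged, through the two implications above, for a metrizable one.

    From any irreducible compactification [K] to the Stone-Cech compactification
    ([stone_cech_irreducible]). The canonical map onto [K] sends no point of the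
    remainder into [X], so no proper closed set is mapped onto [K]. Therefore
    preimages of two points between which [K] is irreducible are two points
    between which the Stone-Cech compactification is irreducible.

    Irreducible to indecomposable for the Stone-Cech compactification
    ([irreducible_compactification_indecomposable]). The complement of a proper
    subcontinuum [C] of an irreducible continuum contains a nonempty connected
    open set [P] ([irreducible_open_connected]). Since disjoint closed sets of
    [X] have disjoint closures, the trace of [P] on [X] is still connected
    ([connected_trace]). It is open and nonempty, so it is dense by
    indecomposability of [X]; hence so is [P], and [C] has empty interior. *)

Set Implicit Arguments.
Unset Strict Implicit.
Unset Printing Implicit Defensive.

Import Order.TTheory GRing.Theory Num.Theory.
Import numFieldTopology.Exports.

Local Open Scope classical_set_scope.
Local Open Scope ring_scope.

(** * Density, embeddings and metrizable spaces *)

Lemma setC_neq0 (T : Type) (A : set T) : A <> [set: T] -> ~` A !=set0.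
Proof.
by move=> AT; apply/set0P/eqP => /(congr1 setC); rewrite setCK setC0.
Qed.

Lemma closedD (T : topologicalType) (A B : set T) :
  closed A -> open B -> closed (A `\` B).
Proof.
by move=> clA oB; rewrite setDE; apply: closedI => //; exact: open_closedC.
Qed.

Lemma dense_closureT (T : topologicalType) (A : set T) :
  dense A -> closure A = [set: T].
Proof.
move=> dA; apply/seteqP; split=> // x _ B; rewrite nbhsE => -[U [oU Ux] UB].
by have [||y [Uy Ay]] := dA U; [exists x | | exists y; split => //; exact: UB].
Qed.

Lemma embedding_openP (T U : topologicalType) (f : T -> U) (A : set T) :
  embedding f -> open A <-> exists2 B, open B & f @^-1` B = A.
Proof. by move=> [_ ->]. Qed.

Lemma embedding_continuous (T U : topologicalType) (f : T -> U) :
  embedding f -> continuous f.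
Proof.
by move=> ef; apply/continuousP => B oB; apply/(embedding_openP _ ef); exists B.
Qed.

Lemma embedding_closure (T U : topologicalType) (f : T -> U) (A : set T) x :
  embedding f -> closed A -> closure (f @` A) (f x) -> A x.
Proof.
move=> ef clA fx; apply: contrapT => nAx.
have /(embedding_openP _ ef)[B oB BA] : open (~` A) by exact: closed_openC.
have /fx[_ [[y Ay <-] By]] : nbhs (f x) B.
  by apply: open_nbhs_nbhs; split=> //; rewrite -[B (f x)]/((f @^-1` B) x) BA.
by have : (~` A) y by rewrite -BA.
Qed.

Lemma embedding_hausdorff (T U : topologicalType) (f : T -> U) :
  embedding f -> hausdorff_space U -> hausdorff_space T.
Proof.
move=> ef hU p q pq; apply: ef.1; apply: hU => A B nA nB.
have cf := embedding_continuous ef.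
have [x [Ax Bx]] := pq _ _ (cf p _ nA) (cf q _ nB).
by exists (f x).
Qed.

Lemma metrizable_hausdorff (R : realType) (T : topologicalType) :
  metrizable R T -> hausdorff_space T.
Proof.
move=> [M [f [ef _]]]; apply: embedding_hausdorff ef _.
exact: metric_hausdorff.
Qed.

Lemma metrizable_normal (R : realType) (T : topologicalType) :
  metrizable R T -> normal_space T.
Proof.
move=> [M [f [ef fT]]]; apply/(@normal_openP R) => A B clA clB AB0.
have cf A' : closed A' -> closed (f @` A').
  move=> clA' y; have [x _ <-] : range f y by rewrite fT.
  by move=> /(embedding_closure ef clA') A'x; exists x.
have nM : normal_space M by exact: (@pseudometric_normal R).
have /(@normal_openP R) /(_ _ _ (cf _ clA) (cf _ clB)) := nM.
case.
  rewrite -subset0 => _ [[a Aa <-] [b Bb /ef.1 ba]].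
  by have : set0 a by rewrite -AB0; split=> //; rewrite -ba.
move=> U [V [oU oV AU BV UV0]].
have /continuousP cof := embedding_continuous ef.
exists (f @^-1` U), (f @^-1` V); split; [exact: cof | exact: cof | | | ].
- by move=> a Aa; apply: AU; exists a.
- by move=> b Bb; apply: BV; exists b.
- by rewrite -preimage_setI UV0 preimage_set0.
Qed.

Definition enumerated_base (T : topologicalType) (b : nat -> set T) :=
  (forall n, open (b n)) /\
  forall (x : T) (U : set T), open U -> U x -> exists n, b n x /\ b n `<=` U.

Lemma separable_metrizable_base (R : realType) (T : topologicalType) :
  separable_space T -> metrizable R T -> exists b, @enumerated_base T b.
Proof.
move=> [D /countable_injP[c cinj] dD] [M [f [ef fT]]].
have cf := embedding_continuous ef.
pose ball' (d : T) (k : nat) :=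
  f @^-1` (interior (ball (f d) (k.+1%:R^-1 : R))).
(* n encodes a point of D, through the injection c, and a radius 1 / (k + 1);
   a code without such a point gives the empty set *)
pose b n := \bigcup_(d in [set d | D d /\ exists k : nat, n = pickle (c d, k)])
   ball' d (odflt (0, 0)%N (unpickle n)).2.
have ob d k : open (ball' d k).
  by move: cf => /continuousP; apply; exact: open_interior.
exists b; split=> [n|x U /(embedding_openP _ ef)[V oV <-] Vfx].
  by apply: bigcup_open.
have /nbhs_ballP[e /= e0 eV] : nbhs (f x) V by exact: open_nbhs_nbhs.
have [//|k] := @ltr_add_invr R 0 (e / 2) _; first by rewrite divr_gt0.
(* a point of the dense set within r / 2 of x, where 2 r < e, has a ball of
   radius r that is a neighborhood of x and lies within e of x *)
rewrite add0r; set r := _^-1 => re.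
have r0 : 0 < r by rewrite /r invr_gt0.
have : (f @^-1` (interior (ball (f x) (r / 2)))) `&` D !=set0.
  apply: dD.
    by exists x; rewrite /= /interior; apply: nbhsx_ballx; rewrite divr_gt0.
  by move: cf => /continuousP; apply; exact: open_interior.
move=> [d [/= /interior_subset xd Dd]].
have bE : b (pickle (c d, k)) = ball' d k.
  rewrite /b pickleK /=; apply/seteqP; split=> [y|y dy]; last first.
    by exists d => //; split => //; exists k.
  move=> [d' [Dd' [k' /(pcan_inj pickleK)[cdd' _]]]].
  by rewrite (cinj d d') ?inE.
exists (pickle (c d, k)); rewrite bE; split=> [|y /interior_subset dy].
  rewrite /ball' /= /interior -/r; near=> z.
  rewrite [r]splitr; apply: (@ball_triangle _ _ (f x)); first exact: ball_sym.
  by near: z; apply: nbhsx_ballx; rewrite divr_gt0.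
apply: eV; rewrite [e]splitr.
apply: (@ball_triangle _ _ (f d)); last exact: le_ball (ltW re) _ dy.
apply: le_ball xd; apply: le_trans (ltW re).
by rewrite ler_pdivrMr// ler_peMr ?ltW// ltr1n.
Unshelve. all: by end_near. Qed.

(** * Compact Hausdorff spaces *)

Lemma normal_disjoint_opens (T : topologicalType) (A B : set T) :
  normal_space T -> closed A -> closed B -> A `&` B = set0 ->
  exists U V, [/\ open U, open V, A `<=` U, B `<=` V & U `&` V = set0].
Proof.
move=> nT clA clB AB0.
have [|W /set_nbhsP[U [oU AU UW]] WB] := nT A clA (~` B).
  apply/set_nbhsP; exists (~` B); split => //; first exact: closed_openC.
  exact/disjoints_subset.
exists U, (~` closure W); split => //.
- exact/closed_openC/closed_closure.
- exact/subsetCr.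
- by apply/disjoints_subset; rewrite setCK => x /UW; exact: subset_closure.
Qed.

Lemma compact_shrink (T : topologicalType) (U : set T) (x : T) :
  compact [set: T] -> hausdorff_space T -> open U -> U x ->
  exists W, [/\ open W, W x & closure W `<=` U].
Proof.
move=> cT hT oU Ux.
have [W + WU] : filter_from (nbhs x) closure U.
  by apply: (compact_regular hT cT); [exact: filterT | exact: open_nbhs_nbhs].
rewrite nbhsE => -[V [oV Vx] VW]; exists V; split => //.
exact: subset_trans (closureS VW) WU.
Qed.

(** If no member of [F] were contained in [O], then the sets [A \ O] would
    generate a filter on [K], with a cluster point in the intersection of [F]
    but outside of [O]. *)
Lemma compact_bigcap_open (T : topologicalType) (K O : set T)
    (F : set (set T)) :
  compact K -> F !=set0 -> (forall A, F A -> closed A /\ A `<=` K) ->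
  (forall A B, F A -> F B -> exists2 C, F C & C `<=` A `&` B) ->
  open O -> \bigcap_(A in F) A `<=` O -> exists2 A, F A & A `<=` O.
Proof.
move=> cK [A0 FA0] clF dirF oO FO; apply: contrapT => nF.
have FO0 A : F A -> A `\` O !=set0.
  move=> FA; apply/set0P/eqP => AO; apply: nF; exists A => //.
  by rewrite -setD_eq0.
have /cK[|p [Kp clp]] : ProperFilter (filter_from F (fun A => A `\` O)).
- apply: filter_from_proper => //; apply: filter_from_filter.
    by exists A0.
  move=> A B FA FB; have [C FC CAB] := dirF _ _ FA FB.
  exists C => // x [Cx nOx].
  by have [] := CAB _ Cx.
- by exists A0 => // x [/((clF _ FA0).2)].
have Ap A : F A -> (A `\` O) p.
  move=> FA; have : closed (A `\` O).
    by apply: closedD => //; exact: (clF _ FA).1.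
  by apply=> B nB; apply: clp => //; exists A.
by apply: (Ap _ FA0).2; apply: FO => A /Ap[].
Qed.

(** Components of a compact Hausdorff space are quasi-components, in a version
    for a set [S] of points: if no connected subset of [K] contains [S], then
    some relatively clopen subset of [K] splits [S]. Otherwise the
    intersection [Q] of the relatively clopen subsets of [K] that contain [S]
    would be connected: two disjoint open sets around the pieces of a partition
    of [Q] already cover one of these clopen sets, which they therefore divide
    into clopen parts, and one of the parts contains [S], hence [Q]. *)
Lemma closed_separation (T : topologicalType) (K S : set T) :
  compact [set: T] -> hausdorff_space T -> closed K -> S !=set0 -> S `<=` K ->
  (forall Q, S `<=` Q -> Q `<=` K -> ~ connected Q) ->
  exists A B, [/\ closed A /\ closed B, A `|` B = K, A `&` B = set0,
                  A `&` S !=set0 & B `&` S !=set0].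
Proof.
move=> cT hT clK [s Ss] SK noQ; apply: contrapT => noAB.
have cut A B : closed A -> closed B -> A `|` B = K -> A `&` B = set0 ->
    S `<=` A \/ S `<=` B.
  move=> clA clB ABK AB0; apply: contrapT.
  move=> /not_orP[/existsNP[x nxA] /existsNP[y nyB]].
  move: nxA nyB => /not_implyP[Sx nAx] /not_implyP[Sy nBy].
  apply: noAB; exists A, B; split => //.
    have : K y by exact: SK.
    by rewrite -ABK => -[Ay|//]; exists y.
  have : K x by exact: SK.
  by rewrite -ABK => -[//|Bx]; exists x.
pose F := [set A | [/\ closed A, closed (K `\` A), A `<=` K & S `<=` A]].
pose Q := \bigcap_(A in F) A.
have FK : F K by split; rewrite // setDv; exact: closed0.
have clQ : closed Q by apply: closed_bigI => A [].
have QK : Q `<=` K by move=> x; exact.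
apply: (noQ Q) => //; first by move=> x Sx A [_ _ _]; exact.
move=> B B0 [C oC BC] [D clD BD].
have clB : closed B by rewrite BD; exact: closedI.
have clQB : closed (Q `\` B).
  have -> : Q `\` B = Q `&` ~` C.
    rewrite BC; apply/seteqP; split=> [x [Qx nQC]|x [Qx nC]]; split => //.
      by move=> Cx; apply: nQC.
    by case.
  by apply: closedI => //; exact: open_closedC.
have BQ : B `<=` Q by rewrite BC; exact: subIsetl.
have BQB0 : B `&` (Q `\` B) = set0 by rewrite setDE setICA setICr setI0.
have nT := compact_normal hT cT.
have [G [H [oG oH BG QBH GH0]]] := normal_disjoint_opens nT clB clQB BQB0.
have [||||||A [clA clKA AK SA] AGH] :=
  @compact_bigcap_open _ K (G `|` H) F.
- exact: subclosed_compact clK cT _.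
- by exists K.
- by move=> A [].
- move=> A A' [clA clKA AK SA] [clA' clKA' AK' SA'].
  exists (A `&` A') => //; split => //.
  + exact: closedI.
  + by rewrite setDIr; exact: closedU.
  + by move=> x [/AK].
  + by move=> x Sx; split; [exact: SA | exact: SA'].
- exact: openU.
- move=> x Qx; have [Bx|nBx] := pselect (B x); first by left; exact: BG.
  by right; exact: QBH.
have AGE : A `&` G = A `\` H.
  apply/seteqP; split=> x [Ax].
    by move=> Gx; split => // Hx; have : set0 x by rewrite -GH0.
  by move=> nHx; split => //; have [] := AGH _ Ax.
have AHE : A `&` H = A `\` G.
  apply/seteqP; split=> x [Ax].
    by move=> Hx; split => // Gx; have : set0 x by rewrite -GH0.
  by move=> nGx; split => //; have [] := AGH _ Ax.
have clAG : closed (A `&` G) by rewrite AGE; exact: closedD.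
have clAH : closed (A `&` H) by rewrite AHE; exact: closedD.
have KAG : K `\` (A `&` G) = (K `\` A) `|` (A `&` H).
  rewrite setDIr AHE; apply/seteqP; split=> x [[Kx ?]|[Kx ?]].
  - by left.
  - by have [Ax|nAx] := pselect (A x); [right | left].
  - by left.
  - by right; split => //; exact: AK.
have KAH : K `\` (A `&` H) = (K `\` A) `|` (A `&` G).
  rewrite setDIr AGE; apply/seteqP; split=> x [[Kx ?]|[Kx ?]].
  - by left.
  - by have [Ax|nAx] := pselect (A x); [right | left].
  - by left.
  - by right; split => //; exact: AK.
have [||||SAG|SKA] := cut (A `&` G) (K `\` (A `&` G)).
- exact: clAG.
- by rewrite KAG; exact: closedU.
- by rewrite setDE setUIr setUCr setIT; apply/setUidPr => x [/AK].
- by rewrite setDE setICA setICr setI0.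
- have QG : Q `<=` G.
    move=> x /(_ (A `&` G)) []//; split => //; last by move=> y [/AK].
    by rewrite KAG; exact: closedU.
  apply/seteqP; split => // x Qx; apply: contrapT => nBx.
  have : set0 x by rewrite -GH0; split; [exact: QG | exact: QBH].
  by [].
- have SAH : S `<=` A `&` H.
    move=> x Sx; have := SKA _ Sx; rewrite KAG => -[[_ /(_ (SA _ Sx))[]]|]//.
  have QH : Q `<=` H.
    move=> x /(_ (A `&` H)) []//; split => //; last by move=> y [/AK].
    by rewrite KAH; exact: closedU.
  have [x Bx] := B0.
  have : set0 x by rewrite -GH0; split; [exact: BG | apply: QH; exact: BQ].
  by [].
Qed.

Lemma compact_baire (T : topologicalType) (F : nat -> set T) :
  compact [set: T] -> hausdorff_space T -> [set: T] !=set0 ->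
  (forall n, closed (F n)) -> (forall n, interior (F n) = set0) ->
  exists x, forall n, ~ F n x.
Proof.
move=> cT hT [t _] clF F0.
(* nested open sets, each with closure inside the previous one minus [F n] *)
pose good := {O : set T | open O /\ O !=set0}.
have step n (O : good) : {O' : good | closure (sval O') `<=` sval O `\` F n}.
  apply: cid; case: O => O [oO [x Ox]] /=.
  have [y [Oy nFy]] : O `\` F n !=set0.
    apply/set0P/eqP; rewrite setD_eq0 => OF.
    suff : interior (F n) x by rewrite F0.
    by rewrite /interior nbhsE; exists O.
  have oOF : open (O `\` F n).
    by rewrite setDE; apply: openI => //; exact: closed_openC.
  have [W [oW Wy WO]] := compact_shrink cT hT oOF (conj Oy nFy).
  by exists (exist _ W (conj oW (ex_intro _ y Wy))).
pose O0 : good := exist _ [set: T] (conj openT (ex_intro _ t I)).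
pose O := fix O n := if n is m.+1 then sval (step m (O m)) else O0.
have OS n : closure (sval (O n.+1)) `<=` sval (O n) `\` F n.
  exact: svalP (step n (O n)).
have OM m n : (m <= n)%N -> sval (O n) `<=` sval (O m).
  move=> /subnK <-; elim: (n - m)%N => // k IH x Ox; apply: IH.
  by apply: (OS _ _ _).1; exact: subset_closure.
have [x Ox] : \bigcap_n closure (sval (O n)) !=set0.
  apply: contrapT => /set0P/negP/negPn/eqP cap0.
  have [||||||A] := @compact_bigcap_open _ [set: T] set0
    (range (fun n => closure (sval (O n)))) => //.
  - by exists (closure (sval (O 0%N))); exists 0%N.
  - by move=> _ [n _ <-]; split => //; exact: closed_closure.
  - move=> _ _ [m _ <-] [n _ <-]; exists (closure (sval (O (maxn m n)))).
      by exists (maxn m n).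
    by move=> x Ox; split; apply: closureS Ox; apply: OM;
      rewrite ?leq_maxl ?leq_maxr.
  - exact: open0.
  - by rewrite bigcap_image cap0.
  move=> [n _ <-] On0; have [y Oy] := (svalP (O n)).2.
  by have : set0 y by apply: On0; exact: subset_closure.
by exists x => n Fx; have [_] := OS n x (Ox n.+1 I).
Qed.

Lemma compact_image_closed (T U : topologicalType) (f : T -> U) (A : set T) :
  compact [set: T] -> hausdorff_space U -> continuous f -> closed A ->
  closed (f @` A).
Proof.
move=> cT hU cf clA; apply: compact_closed => //; apply: continuous_compact.
  exact: continuous_subspaceT.
exact: subclosed_compact clA cT _.
Qed.

(** * Compactifications inside powers of the real line *)

Lemma continuous_product (T : topologicalType) (J : eqType)
    (U : J -> topologicalType) (f : T -> prod_topology U) :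
  (forall j, continuous (fun x => f x j)) -> continuous f.
Proof.
move=> cf x; apply/cvg_sup => i; move: x.
apply/(@continuousP _ (initial_topology (@^~ i))) => _ [B oB <-].
by have /continuousP := cf i; exact.
Qed.

Section capped_metric.
Context {R : realType} {T : pseudoMetricType R}.
Hypothesis hT : hausdorff_space T.

(** A copy of [T], which will carry the distance capped at 1: the distance
    [edist] associated with the balls of [T] may be infinite. *)
Definition capped : Type := let _ := hT in T.

HB.instance Definition _ := Choice.on capped.

Definition capped_dist (x y : T) : R := fine (Order.min (edist (x, y)) 1%E).

Let capped_distE (x y : T) :
  (capped_dist x y)%:E = Order.min (edist (x, y)) 1%E.
Proof.
rewrite /capped_dist fineK// ge0_fin_numE ?le_min ?edist_ge0 ?lee01//.
by rewrite gt_min ltry orbT.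
Qed.

Let capped_distxx (x : capped) : capped_dist x x = 0.
Proof. by rewrite /capped_dist edist_refl min_l. Qed.

Let capped_dist_eq0 (x y : capped) : capped_dist x y = 0 -> x = y.
Proof.
move=> xy0; have := capped_distE x y; rewrite xy0.
case: leP => [_ /esym/edist_closeP|_ [/esym/eqP]]; first by rewrite closeE.
by rewrite oner_eq0.
Qed.

Let capped_dist_sym (x y : capped) : capped_dist x y = capped_dist y x.
Proof. by rewrite /capped_dist edist_sym. Qed.

Let capped_dist_triangle (y x z : capped) :
  capped_dist x z <= capped_dist x y + capped_dist y z.
Proof.
rewrite -lee_fin EFinD !capped_distE ge_min.
have [xy1|xy1] := leP (edist (x, y)) 1%E; last first.
  by apply/orP; right; rewrite leeDl// le_min edist_ge0 lee01.
have [yz1|yz1] := leP (edist (y, z)) 1%E; last first.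
  by apply/orP; right; rewrite leeDr// edist_ge0.
by rewrite edist_triangle.
Qed.

HB.instance Definition _ := @isMetric.Build R capped capped_dist
  capped_distxx capped_dist_eq0 capped_dist_sym capped_dist_triangle.

(** The metric is rebuilt because in a pseudometric space a ball need not be
    the set of points at distance less than its radius from its center. *)
Lemma pseudometric_metrizable : metrizable R T.
Proof.
exists capped, (id : T -> capped); split; last first.
  by apply/seteqP; split => // x _; exists x.
split => //; apply/seteqP; split=> [U oU|U [V oV <-]].
  exists U => //; rewrite openE => x Ux.
  have /nbhs_ballP[e /= e0 eU] : @nbhs T T x U by exact: open_nbhs_nbhs.
  apply/nbhs_ballP; exists (Order.min e 1); first by rewrite /= lt_min e0 ltr01.
  move=> y; rewrite ballEmdist/= => xy; apply: eU.
  apply: (@edist_lt_ball R T e (x, y)).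
  move: xy; rewrite -lte_fin capped_distE EFin_min lt_min => /andP[].
  move=> /[swap]; rewrite gt_min ltxx orbF => /ltW/min_l -> //.
change (@open T V); rewrite openE => x Vx.
have /nbhs_ballP[e /= e0 eV] : @nbhs capped capped x V by exact: open_nbhs_nbhs.
apply/nbhs_ballP; exists (e / 2); first by rewrite /= divr_gt0.
move=> y xy; apply: eV; rewrite ballEmdist/=.
rewrite -lte_fin capped_distE gt_min; apply/orP; left.
apply: (@le_lt_trans _ _ (e / 2)%:E).
  by apply: (@edist_fin R T (e / 2) (x, y)) => //; rewrite divr_gt0.
by rewrite lte_fin ltr_pdivrMr// ltr_pMr// ltr1n.
Qed.

End capped_metric.

Lemma compact_set_type (T : topologicalType) (A : set T) :
  compact A -> compact [set: set_type A].
Proof.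
move=> cA F PF _.
have [|p [Ap clp]] := cA (set_val @ F) _.
  rewrite /= /fmap /= (_ : _ @^-1` _ = setT); first exact: filterT.
  by apply/seteqP; split=> // x _; exact: (set_valP x).
exists (SigSub (mem_set Ap)); split=> // B N FB [_ [[W oW <-] Wp] WN].
have [_ [[x Bx <-] Wx]] : (set_val @` B) `&` W !=set0.
  apply: clp; last exact: open_nbhs_nbhs.
  by rewrite /fmap/=; apply: filterS FB; exact: preimage_image.
by exists x; split => //; exact: WN.
Qed.

Section product_closure.
Context {R : realType} {X : topologicalType} {I : choiceType}.
Variable f : I -> X -> R.

Let box : topologicalType := prod_topology (fun _ : I => (R : topologicalType)).

Definition product_closure : topologicalType :=
  set_type (closure (range (join_product f : X -> box))).

Definition into_product_closure (x : X) : product_closure :=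
  SigSub (mem_set (subset_closure (imageT (join_product f : X -> box) x))).

Lemma product_coordinate_continuous (i : I) :
  continuous (fun z : product_closure => set_val z i : R).
Proof.
move=> z.
apply: (@continuous_comp _ _ _ (set_val : product_closure -> box) (proj i)).
  exact: initial_continuous.
exact: proj_continuous.
Qed.

Hypothesis f_cont : forall i, continuous (f i).
Hypothesis f_itv : forall i x, 0 <= f i x <= 1.

Lemma product_closure_hausdorff : hausdorff_space product_closure.
Proof.
apply: (@embedding_hausdorff _ _ (set_val : product_closure -> box)).
  by split=> //; exact: val_inj.
by apply: hausdorff_product => i; exact: Rhausdorff.
Qed.

Lemma product_closure_compact : compact [set: product_closure].
Proof.
apply: compact_set_type.
have cB : compact [set g : box | forall i, `[0, 1]%classic (g i)].
  apply: (@tychonoff I (fun=> (R : topologicalType))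
            (fun=> `[0, 1]%classic)) => i.
  exact: segment_compact.
apply: (subclosed_compact (@closed_closure _ _) cB).
have clB : closed [set g : box | forall i, `[0, 1]%classic (g i)].
  apply: compact_closed => //.
  by apply: hausdorff_product => i; exact: Rhausdorff.
suff fB : range (join_product f : X -> box)
    `<=` [set g | forall i, `[0, 1]%classic (g i)].
  by apply: subset_trans (closureS fB) _; exact: clB.
by move=> _ [x _ <-] i /=; rewrite in_itv/= f_itv.
Qed.

Lemma into_product_closure_dense : dense (range into_product_closure).
Proof.
move=> O [y Oy] [W oW WE]; move: Oy; rewrite -WE => Wy.
have [_ [[x _ <-] Wx]] := set_valP y W (open_nbhs_nbhs (conj oW Wy)).
by exists (into_product_closure x); split => //; exists x.
Qed.

Lemma product_closure_compactification :
  accessible_space X -> separate_points_from_closed f ->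
  compactification into_product_closure.
Proof.
move=> T1 sepf; split.
- exact: product_closure_compact.
- exact: product_closure_hausdorff.
- have inj := join_product_inj sepf T1; split.
    by move=> x y /(congr1 set_val) xy; apply: inj; rewrite ?inE.
  rewrite (join_product_initial sepf f_cont inj).
  apply/seteqP; split=> [_ [W oW <-]|_ [_ [W oW <-] <-]]; last by exists W.
  by exists (set_val @^-1` W) => //; exists W.
- exact: into_product_closure_dense.
Qed.

End product_closure.

Lemma product_closure_metrizable (R : realType) (X : topologicalType)
    (I : countType) (f : I -> X -> R) :
  metrizable R (product_closure f).
Proof.
pose P := prod_topology (fun _ : I => (R : pseudoMetricType R)).
apply: (@pseudometric_metrizable R
  (set_type (closure (range (join_product f : X -> P))))).
exact: product_closure_hausdorff.
Qed.

(** * Urysohn functions and closures in a compactification *)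

Lemma normal_urysohn (R : realType) (T : topologicalType) (A B : set T) :
  normal_space T -> closed A -> closed B -> A `&` B = set0 ->
  exists g : T -> R, [/\ @unit_functions R T g,
    forall x, A x -> g x = 0 & forall x, B x -> g x = 1].
Proof.
move=> /(@normal_separatorP R) nT clA clB AB0.
have /(@uniform_separatorP _ R)[g [cg g01 gA gB]] := nT A B clA clB AB0.
exists g; split.
- split=> // x; have : range g (g x) by exists x.
  by move=> /g01; rewrite /= in_itv.
- by move=> x Ax; apply: gA; exists x.
- by move=> x Bx; apply: gB; exists x.
Qed.

Lemma closure_level (R : realType) (X K : topologicalType) (e : X -> K)
    (h : K -> R) (A : set X) (r : R) :
  continuous h -> (forall x, A x -> h (e x) = r) ->
  forall z, closure (e @` A) z -> h z = r.
Proof.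
move=> /continuous_closedP ch hA z.
have clr : closed (h @^-1` [set r]).
  by apply: ch; exact/accessible_closed_set1/hausdorff_accessible/Rhausdorff.
move=> cz; apply: (clr z); apply: closureS cz => _ [x Ax <-]; exact: hA.
Qed.

Lemma urysohn_notin_closure (R : realType) (X : topologicalType) (g : X -> R)
    (U : set X) (x : X) :
  g x = 0 -> (forall y, U y -> g y = 1) -> ~ closure (g @` U) (g x).
Proof.
move=> -> g1 c0; have /eqP : (0 : R) = 1; last by rewrite eq_sym oner_eq0.
apply: (@closure_level R X R g id U 1 _ g1 _ c0) => z.
exact: cvg_id.
Qed.

Lemma closures_disjoint (R : realType) (X K : topologicalType) (e : X -> K)
    (h : K -> R) (A B : set X) :
  continuous h -> (forall x, A x -> h (e x) = 0) ->
  (forall x, B x -> h (e x) = 1) ->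
  closure (e @` A) `&` closure (e @` B) = set0.
Proof.
move=> ch hA hB; rewrite -subset0 => z [Az Bz].
have := closure_level ch hA Az; rewrite (closure_level ch hB Bz) => /eqP.
by rewrite oner_eq0.
Qed.

Lemma dense_range_closure (X K : topologicalType) (e : X -> K) (P : set K) :
  dense (range e) -> open P -> P `<=` closure (e @` (e @^-1` P)).
Proof.
move=> de oP y Py N; rewrite nbhsE => -[W [oW Wy] WN].
have [||z [[Pz Wz] [x _ ex]]] := de (P `&` W); first by exists y.
  exact: openI.
by exists (e x); rewrite ex; split; [exists x; rewrite //= ex | exact: WN].
Qed.

(** * Indecomposable compactifications and strong indecomposability *)

Lemma indecomposableP (Y : topologicalType) :
  indecomposable Y <-> forall C : set Y, closed C -> connected C ->
    C <> [set: Y] -> interior C = set0.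
Proof.
split=> [indY C clC coC CT|indY C coC].
  have [dC|] := indY C coC.
    by exfalso; apply: CT; rewrite -(dense_closureT dC); exact/closure_id.
  by rewrite /nowhere_dense -(closure_id C).1.
have [CT|CT] := pselect (closure C = [set: Y]).
  left=> O [x Ox] oO; have : closure C x by rewrite CT.
  by move=> /(_ O (open_nbhs_nbhs (conj oO Ox)))[y [Cy Oy]]; exists y.
right; apply: indY => //; first exact: closed_closure.
exact: connected_closure.
Qed.

Definition is_cut (X : topologicalType) (U V A B : set X) :=
  [/\ closed A /\ closed B, A `|` B = [set: X], A `&` U !=set0,
      B `&` U !=set0 & A `&` B `<=` V].

Lemma compactification_strongly_indecomposable (X K : topologicalType)
    (e : X -> K) :
  compactification e -> indecomposable K -> strongly_indecomposable X.
Proof.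
move=> [cK hK ee de] /indecomposableP indK U V oU oV [u Uu] [v Vv] UV0.
have [U' oU' UE] := (embedding_openP _ ee).1 oU.
have [V' oV' VE] := (embedding_openP _ ee).1 oV.
have UV0' : U' `&` V' = set0.
  apply: contrapT => /eqP/set0P ne.
  have [z [[Uz Vz] [x _ ex]]] := de _ ne (openI oU' oV').
  by have : set0 x by rewrite -UV0 -UE -VE /= ex.
have [|W [oW Wv WV']] := compact_shrink cK hK oV' (x := e v).
  by rewrite -VE in Vv.
have U'u : U' (e u) by rewrite -UE in Uu.
have [|||Q U'Q QW coQ|A [B [[clA clB] AB AB0 [a [Aa Ua]] [b [Bb Ub]]]]] :=
  @closed_separation K (~` W) U' cK hK.
- exact: open_closedC.
- by exists (e u).
- move=> x Ux Wx; have : set0 x; last by [].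
  by rewrite -UV0'; split => //; apply/WV'/subset_closure.
- have clQ' : closure Q `<=` ~` W.
    by apply: subset_trans (closureS QW) (open_closedC oW).
  have : interior (closure Q) (e u).
    rewrite /interior nbhsE; exists U' => //.
    by apply: subset_trans (@subset_closure _ _).
  rewrite indK//; [exact: closed_closure|exact: connected_closure|].
  move=> QT; have : closure Q (e v) by rewrite QT.
  by move=> /clQ'; apply.
have ce := embedding_continuous ee; move/continuous_closedP : (ce) => cle.
have hit A' B' a' : closed B' -> A' `|` B' = ~` W -> A' `&` B' = set0 ->
    A' a' -> U' a' -> exists2 x, U x & A' (e x).
  move=> clB' AB' AB0' Aa' Ua'.
  have [||y [[Uy nBy] [x _ ex]]] := de (U' `\` B').
  - exists a'; split => // Ba'.
    by have : set0 a' by rewrite -AB0'.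
  - by rewrite setDE; apply: openI => //; exact: closed_openC.
  exists x; first by rewrite -UE /= ex.
  have : (~` W) (e x).
    rewrite ex => Wy; have : set0 y; last by [].
    by rewrite -UV0'; split => //; apply/WV'/subset_closure.
  by rewrite -AB' ex => -[].
have [x Ux Ax] := hit A B a clB AB AB0 Aa Ua.
have [y Uy By] : exists2 x, U x & B (e x).
  by apply: (hit B A b clA _ _ Bb Ub); [rewrite setUC|rewrite setIC].
exists (e @^-1` (A `|` closure W)), (e @^-1` (B `|` closure W)); split.
- by split; apply: cle; apply: closedU => //; exact: closed_closure.
- apply/seteqP; split => // z _.
  have [Wz|] := pselect (W (e z)); first by left; right; exact: subset_closure.
  by rewrite -[~ _]/((~` W) (e z)) -AB => -[Az|Bz]; [left; left|right; left].
- by exists x; split => //; left.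
- by exists y; split => //; left.
- move=> z [[Az|Wz] [Bz|Wz']]; rewrite -VE; do ?exact: WV'.
  by have : set0 (e z) by rewrite -AB0.
Qed.

(** If the two sides of each cut have disjoint closures in [K] away from
    [b n], then a proper subcontinuum [C] with nonempty interior is impossible:
    for [b m] inside [C] and [b n] away from [C], it would lie on one side, but
    it contains [b m], which meets both sides. *)
Lemma base_cuts_indecomposable (X K : topologicalType) (e : X -> K)
    (b : nat -> set X) :
  compactification e -> enumerated_base b ->
  (forall m n, b m !=set0 -> b n !=set0 -> b m `&` b n = set0 ->
    exists2 AB, is_cut (b m) (b n) AB.1 AB.2 &
      closure (e @` (AB.1 `\` b n)) `&` closure (e @` (AB.2 `\` b n)) = set0) ->
  indecomposable K.
Proof.
move=> [cK hK ee de] [ob bb] cuts.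
apply/indecomposableP => C clC coC CT; apply: contrapT => /eqP/set0P[y Cy].
have [w nCw] := setC_neq0 CT.
have [W [oW Ww WC]] := compact_shrink cK hK (closed_openC clC) nCw.
have [||u [Cu [x _ xu]]] := de (interior C).
- by exists y.
- exact: open_interior.
have [||v [Wv [x' _ xv]]] := de W; [by exists w | exact: oW |].
have /continuousP oe := embedding_continuous ee.
have [||m [bmx bmC]] := bb x (e @^-1` (interior C)).
- by apply: oe; exact: open_interior.
- by rewrite /= xu.
have [||n [bnx bnW]] := bb x' (e @^-1` W).
- exact: oe.
- by rewrite /= xv.
have bmn0 : b m `&` b n = set0.
  rewrite -subset0 => z [/bmC Cz /bnW Wz].
  by apply: (WC (e z)); [exact: subset_closure|exact: interior_subset].
have [|||[A B] /= [[clA clB] AB Am Bm ABn] FG0] := cuts m n.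
- by exists x.
- by exists x'.
- exact: bmn0.
have clU : closed (closure (e @` (A `\` b n)) `|` closure (e @` (B `\` b n)) `|`
    closure (e @` b n)).
  by do ?apply: closedU; exact: closed_closure.
have cover z : (closure (e @` (A `\` b n)) `|` closure (e @` (B `\` b n)) `|`
    closure (e @` b n)) z.
  have : closure (range e) z by rewrite dense_closureT.
  apply: subset_trans (closureS _) clU z => _ [t _ <-].
  have [bt|nbt] := pselect (b n t).
    by right; apply: subset_closure; exists t.
  have : (A `|` B) t by rewrite AB.
  by move=> [At|Bt]; left; [left|right]; apply: subset_closure; exists t.
have CFG : C `<=` closure (e @` (A `\` b n)) `|` closure (e @` (B `\` b n)).
  move=> z Cz; have [//|nz] := cover z; exfalso.
  apply: (WC z) => //; apply: closureS nz => _ [t bt <-]; exact: bnW.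
have nomiss A' B' : closed A' -> A' `&` B' `<=` b n -> B' `&` b m !=set0 ->
    ~ (C `<=` closure (e @` (A' `\` b n))).
  move=> clA' AB' [t [Bt bt]] CA.
  have [At nbt] : (A' `\` b n) t.
    apply: (embedding_closure ee); first exact: closedD.
    by apply: CA; apply: interior_subset; exact: (bmC t).
  by apply: nbt; apply: AB'.
have [||] := @connected_subset _ (closure (e @` (A `\` b n)))
    (closure (e @` (B `\` b n))) C _ CFG coC.
- by split; rewrite -(closure_id (closure _)).1//; exact: closed_closure.
- exact: nomiss clA ABn Bm.
- by apply: nomiss clB _ Am; rewrite setIC.
Qed.

Lemma strongly_indecomposable_metrizable_compactification (R : realType)
    (X : topologicalType) (b : nat -> set X) :
  normal_space X -> hausdorff_space X -> enumerated_base b ->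
  strongly_indecomposable X ->
  exists (K : topologicalType) (e : X -> K),
    [/\ compactification e, metrizable R K & indecomposable K].
Proof.
move=> nX hX bX sX; have [ob bb] := bX.
have T1 := hausdorff_accessible hX.
have u0 : @unit_functions R X (fun=> 0).
  by split=> [x|x]; [exact: cvg_cst | rewrite lexx ler01].
(* by normality, the pairs with closure (b m) inside b n are enough to separate
   points from closed sets, so these functions determine the topology of X *)
have /choice[emb embP] (mn : nat * nat) : exists g : X -> R,
    @unit_functions R X g /\ (closure (b mn.1) `<=` b mn.2 ->
      (forall x, b mn.1 x -> g x = 0) /\ (forall x, ~ b mn.2 x -> g x = 1)).
  have [bmn|nbmn] := pselect (closure (b mn.1) `<=` b mn.2).
    have [||g [ug g0 g1]] := @normal_urysohn R X _ (~` b mn.2) nX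
      (@closed_closure _ (b mn.1)).
    - exact: open_closedC.
    - by apply/disjoints_subset; rewrite setCK.
    exists g; split=> // _; split=> // x bx.
    by apply: g0; exact: subset_closure.
  by exists (fun=> 0).
have /choice[sep sepP] (mn : nat * nat) : exists g : X -> R,
    @unit_functions R X g /\
    (b mn.1 !=set0 -> b mn.2 !=set0 -> b mn.1 `&` b mn.2 = set0 ->
      exists2 AB, is_cut (b mn.1) (b mn.2) AB.1 AB.2 &
        (forall x, (AB.1 `\` b mn.2) x -> g x = 0) /\
        (forall x, (AB.2 `\` b mn.2) x -> g x = 1)).
  have [[bm bn bmn]|nbmn] := pselect [/\ b mn.1 !=set0, b mn.2 !=set0 &
      b mn.1 `&` b mn.2 = set0]; last first.
    by exists (fun=> 0); split=> // bm bn bmn; exfalso; apply: nbmn.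
  have [A [B cutAB]] := sX _ _ (ob _) (ob _) bm bn bmn.
  have [[clA clB] _ _ _ ABn] := cutAB.
  have [|||g [ug g0 g1]] :=
    @normal_urysohn R X (A `\` b mn.2) (B `\` b mn.2) nX.
  - exact: closedD.
  - exact: closedD.
  - by rewrite -subset0 => x [[Ax nb] [Bx _]]; apply: nb; exact: ABn.
  by exists g; split=> // _ _ _; exists (A, B).
pose f (i : bool * (nat * nat)) : X -> R := if i.1 then emb i.2 else sep i.2.
have uf i : @unit_functions R X (f i).
  by case: i => [[] mn]; [exact: (embP mn).1 | exact: (sepP mn).1].
have cK : compactification (into_product_closure f).
  apply: product_closure_compactification => //.
  - by move=> i; exact: (uf i).1.
  - by move=> i; exact: (uf i).2.
  move=> U x clU nUx.
  have [n [bnx bnU]] := bb x _ (closed_openC clU) nUx.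
  have [W [oW Wx Wb]] : exists W, [/\ open W, W x & closure W `<=` b n].
    have [|||W [V [oW oV xW bV WV0]]] :=
      @normal_disjoint_opens X [set x] (~` b n) nX.
    - exact: accessible_closed_set1.
    - exact: open_closedC.
    - by apply/disjoints_subset; rewrite setCK => _ ->.
    exists W; split => //; first exact: xW.
    apply: (@subset_trans _ (~` V)).
      apply: subset_trans (closureS _) (open_closedC oV).
      exact/disjoints_subset.
    by move=> z nVz; apply: contrapT => /bV.
  have [m [bmx bmW]] := bb x _ oW Wx.
  have [_ []] := embP (m, n); first exact: subset_trans (closureS bmW) Wb.
  move=> g0 g1; exists (true, (m, n)).
  apply: (@urysohn_notin_closure R X (emb (m, n))); first exact: g0.
  by move=> y Uy; apply: g1 => /bnU.
exists (product_closure f), (into_product_closure f); split=> //.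
  exact: product_closure_metrizable.
apply: base_cuts_indecomposable cK bX _ => m n bm bn bmn.
have [_ /(_ bm bn bmn)[AB cutAB [g0 g1]]] := sepP (m, n).
exists AB => //.
apply: (@closures_disjoint R X _ _
  (fun z : product_closure f => set_val z (false, (m, n)))) => //.
exact: product_coordinate_continuous.
Qed.

(** * Irreducibility from a countable base *)

Lemma composant_refl (Y : topologicalType) (q : Y) :
  hausdorff_space Y -> (exists x y : Y, x <> y) -> composant q q.
Proof.
move=> hY [x [y xy]].
have T1 := accessible_closed_set1 (hausdorff_accessible hY).
exists [set q] => //; split => //; first exact: connected1.
move=> qT; apply: xy; have : [set q] x /\ [set q] y by rewrite qT.
by move=> [-> ->].
Qed.

(** A proper subcontinuum containing [p] misses a nonempty basic open set
    [b n], so it lies in the component of [p] in the complement of [b n]: these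
    components cover the composant of [p], and the Baire category theorem gives
    a point outside of all of them. *)
Lemma countable_base_irreducible (Y : topologicalType) (b : nat -> set Y) :
  continuum Y -> enumerated_base b -> (exists p q : Y, p <> q) ->
  indecomposable Y -> irreducible Y.
Proof.
move=> contY [ob bb] pq /indecomposableP indY; have [p _] := pq.
have [cY hY coY] := contY; split=> //.
(* an empty [b n] must be discarded: its complement is the whole space *)
pose F n := [set y | b n !=set0 /\ connected_component (~` b n) p y].
have FE n : b n !=set0 -> F n = connected_component (~` b n) p.
  by move=> bn; apply/seteqP; split=> y => [[]|].
have F0 n : ~ (b n !=set0) -> F n = set0.
  by move=> bn; rewrite -subset0 => y [].
have clF n : closed (F n).
  have [bn|/F0 ->] := pselect (b n !=set0); last exact: closed0.
  by rewrite FE//; apply: component_closed; exact: open_closedC.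
have [||z zF] := @compact_baire Y F cY hY _ clF.
- by exists p.
- move=> n; apply: indY => //.
    have [bn|/F0 ->] := pselect (b n !=set0); last exact: connected0.
    by rewrite FE//; exact: component_connected.
  have [bn|/F0 ->] := pselect (b n !=set0); last first.
    by move=> /esym T0; have : set0 p by rewrite -T0.
  move=> FT; case: bn => y by_; have : F n y by rewrite FT.
  by rewrite FE; last (by exists y); move=> /connected_component_sub.
exists p, z => E; have := composant_refl z hY pq.
rewrite -E => -[C [clC coC CT Cp] Cz].
have [y nCy] := setC_neq0 CT.
have [n [bny bnC]] := bb y _ (closed_openC clC) nCy.
apply: (zF n); rewrite FE; last by exists y.
by exists C => //; split => //; exact: subsetCr.
Qed.

(** * The Stone-Cech compactification *)

Definition stone_cech_embedding (R : realType) (X : topologicalType) :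
  X -> stone_cech R X :=
  into_product_closure (fun g : @unit_functions R X => set_val g).

Lemma stone_cech_embedding_compactification (R : realType)
    (X : topologicalType) :
  normal_space X -> hausdorff_space X ->
  compactification (@stone_cech_embedding R X).
Proof.
move=> nX hX.
have T1 := hausdorff_accessible hX.
apply: product_closure_compactification => //.
- by move=> g; exact: (set_valP g).1.
- by move=> g; exact: (set_valP g).2.
move=> U x clU nUx.
have [|||g [ug gx gU]] := @normal_urysohn R X [set x] U nX.
- exact: accessible_closed_set1.
- by [].
- by apply/disjoints_subset => _ ->.
exists (SigSub (mem_set ug)).
by apply: (@urysohn_notin_closure R X g) => //; exact: gx.
Qed.

Lemma stone_cech_closures_disjoint (R : realType) (X : topologicalType)
    (A B : set X) :
  normal_space X -> closed A -> closed B -> A `&` B = set0 ->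
  closure (@stone_cech_embedding R X @` A) `&`
  closure (@stone_cech_embedding R X @` B) = set0.
Proof.
move=> nX clA clB AB0.
have [g [ug g0 g1]] := @normal_urysohn R X A B nX clA clB AB0.
pose i : @unit_functions R X := SigSub (mem_set ug).
apply: (@closures_disjoint R X _ _
  (fun z : stone_cech R X => set_val z i)) => //.
exact: product_coordinate_continuous.
Qed.

(** Composing unit functions on [K] with [g] induces a map from the power of
    the line that defines the Stone-Cech compactification of [X] to the one
    that contains [K]. It sends a dense subset into the compact image of [K],
    hence everything. *)
Lemma stone_cech_extension (R : realType) (X K : topologicalType) (g : X -> K) :
  compact [set: K] -> hausdorff_space K -> continuous g ->
  exists2 h : stone_cech R X -> K, continuous h &
    forall x, h (@stone_cech_embedding R X x) = g x.
Proof.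
move=> cK hK cg.
have pullP (k : @unit_functions R K) : @unit_functions R X (set_val k \o g).
  have [ck k01] := set_valP k; split; last by move=> x; exact: k01.
  by move=> x; apply: continuous_comp; [exact: cg | exact: ck].
pose pull k : @unit_functions R X := SigSub (mem_set (pullP k)).
pose star (z : stone_cech R X) : cube R K := fun k => set_val z (pull k).
have cstar : continuous star.
  by apply: continuous_product => k; exact: product_coordinate_continuous.
have cev : continuous (@evaluation R K).
  by apply: continuous_product => k; exact: (set_valP k).1.
have hcube : hausdorff_space (cube R K).
  by apply: hausdorff_product => k; exact: Rhausdorff.
have clev F : closed F -> closed (@evaluation R K @` F).
  exact: compact_image_closed.
have evI : injective (@evaluation R K).
  move=> x y xy; apply: contrapT => nxy.
  have cl1 := accessible_closed_set1 (hausdorff_accessible hK).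
  have [|k [uk k0 k1]] := @normal_urysohn R K _ _ (compact_normal hK cK)
    (cl1 x) (cl1 y).
    by rewrite -subset0 => z [-> yx]; apply: nxy.
  have /eqP : k x = k y := congr1 (@^~ (SigSub (mem_set uk))) xy.
  by rewrite k0// k1// eq_sym oner_eq0.
have starP z : range (@evaluation R K) (star z).
  have clr : closed (star @^-1` range (@evaluation R K)).
    by move/continuous_closedP : cstar; apply; exact: clev.
  have : closure (range (@stone_cech_embedding R X)) z.
    by rewrite dense_closureT//; exact: into_product_closure_dense.
  apply: subset_trans (closureS _) clr z => _ [x _ <-].
  by exists (g x).
pose h z := sval (cid2 (starP z)).
have hP z : evaluation (h z) = star z by rewrite /h; case: cid2.
exists h; last by move=> x; apply: evI; rewrite hP.
apply/continuous_closedP => F clF.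
have -> : h @^-1` F = star @^-1` (@evaluation R K @` F).
  apply/seteqP; split=> z /=; first by rewrite -hP => Fh; exists (h z).
  by rewrite -hP => -[k Fk /evI <-].
by move/continuous_closedP : cstar; apply; exact: clev.
Qed.

(** A point [z] other than [d x] has a neighborhood whose trace on [X] avoids a
    neighborhood of [x]. As the topology of [X] is induced from [L], the image
    of that trace avoids a neighborhood of [e x], and [h z] lies in its
    closure. *)
Lemma remainder_preserved (X K L : topologicalType) (d : X -> K) (e : X -> L)
    (h : K -> L) (z : K) (x : X) :
  hausdorff_space K -> embedding d -> dense (range d) -> embedding e ->
  continuous h -> (forall t, h (d t) = e t) -> h z = e x -> z = d x.
Proof.
move=> hK ed dd ee ch hd hz; apply: contrapT => /eqP zx.
move: hK; rewrite open_hausdorff => /(_ _ _ zx)[[U V] /=].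
move=> [/set_mem Uz /set_mem Vx] [oU oV /eqP UV0].
have [W oW WE] : exists2 W, open W & e @^-1` W = d @^-1` V.
  apply/(embedding_openP _ ee); move/continuousP : (embedding_continuous ed).
  exact.
have [||y [[Uy Wy] [t _ ty]]] := dd (U `&` h @^-1` W).
- exists z; split => //=; rewrite hz -[W _]/((e @^-1` W) x) WE//.
- by apply: openI => //; move/continuousP : ch; exact.
have : (e @^-1` W) t by rewrite /= -hd ty.
rewrite WE /= ty => Vy.
by have : set0 y by rewrite -UV0.
Qed.

Lemma compactification_connected (X K : topologicalType) (e : X -> K) :
  compactification e -> connected [set: X] -> connected [set: K].
Proof.
move=> [_ _ ee de] coX; rewrite -(dense_closureT de).
apply: connected_closure; apply: connected_continuous_connected => //.
exact/continuous_subspaceT/embedding_continuous.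
Qed.

(** * Irreducibility of the Stone-Cech compactification *)

Lemma irreducible_between (Y : topologicalType) :
  irreducible Y -> exists p q : Y,
    forall C, closed C -> connected C -> C p -> C q -> C = [set: Y].
Proof.
move=> [_ [p [q pq]]].
wlog /existsNP[x /not_implyP[px qx]] : p q pq /
    ~ (composant p `<=` composant q).
  have [pqs|npq] := pselect (composant p `<=` composant q); last first.
    by apply; [exact: pq|].
  move=> /(_ q p); apply; first by move=> /esym.
  by move=> qps; apply: pq; apply/seteqP.
exists q, x => C clC coC Cq Cx; apply: contrapT => CT; apply: qx.
by exists C.
Qed.

Lemma between_irreducible (Y : topologicalType) (p q : Y) :
  continuum Y -> (exists x y : Y, x <> y) ->
  (forall C, closed C -> connected C -> C p -> C q -> C = [set: Y]) ->
  irreducible Y.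
Proof.
move=> cY xy pqY; split=> //; exists p, q => E.
have [_ hY _] := cY; have := composant_refl q hY xy.
by rewrite -E => -[C [clC coC CT Cp] Cq]; apply: CT; exact: pqY.
Qed.

Lemma stone_cech_irreducible (R : realType) (X K : topologicalType)
    (e : X -> K) :
  normal_space X -> hausdorff_space X -> connected [set: X] ->
  (exists x y : X, x <> y) -> compactification e -> irreducible K ->
  irreducible (stone_cech R X).
Proof.
move=> nX hX coX [x0 [y0 xy0]] ce irK.
have cb := stone_cech_embedding_compactification R nX hX.
have [cK hK ee de] := ce; have [cB hB eb db] := cb.
have [h ch hE] := stone_cech_extension R cK hK (embedding_continuous ee).
have coB := compactification_connected cb coX.
have clh F : closed F -> closed (h @` F).
  exact: compact_image_closed.
have hT k : range h k.
  have : closure (range e) k by rewrite dense_closureT.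
  apply: subset_trans (closureS _) (clh _ closedT) k => _ [x _ <-].
  by rewrite -hE; exists (stone_cech_embedding R x).
have [p [q pqK]] := irreducible_between irK.
have [p' _ hp] := hT p; have [q' _ hq] := hT q.
apply: (@between_irreducible _ p' q') => //.
  by exists (stone_cech_embedding R x0), (stone_cech_embedding R y0) => /eb.1.
move=> C clC coC Cp Cq.
have hCT : h @` C = [set: K].
  apply: pqK; [exact: clh | | by exists p' | by exists q'].
  by apply: connected_continuous_connected => //; exact: continuous_subspaceT.
apply/seteqP; split=> // z _; apply: contrapT => nCz.
have [||y [nCy [x _ xy]]] := db (~` C); [by exists z | exact: closed_openC |].
have [c Cc hc] : (h @` C) (e x) by rewrite hCT.
apply: nCy; rewrite -xy.
by rewrite -(remainder_preserved hB eb db ee ch hE hc).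
Qed.

(** * Complements of subcontinua of an irreducible continuum *)

(** In a separation of [C `|` P] with [C] on one side, the other side lies in
    [P], which is separated from [Q]. Adding [Q] to the side of [C] would
    therefore separate the whole space. *)
Lemma connected_setU_part (Y : topologicalType) (C P Q : set Y) :
  connected [set: Y] -> connected C -> open P -> open Q -> P `&` Q = set0 ->
  ~` C = P `|` Q -> connected (C `|` P).
Proof.
move=> coY coC oP oQ PQ0 CPQ; apply: contrapT => /connectedPn[E [E0 EU sE]].
wlog CE : E E0 EU sE / C `<=` E false.
  move=> IH; have [|CE|CE] := @connected_subset _ (E false) (E true) C sE _ coC.
  - by rewrite -EU => z; left.
  - exact: IH CE.
  - apply: (IH (E \o negb)) => //=; first by rewrite EU setUC.
    by rewrite separatedC.
have E1P : E true `<=` P.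
  move=> z Ez; have : (C `|` P) z by rewrite EU; right.
  move=> -[/CE E0z|//]; exfalso.
  by have : set0 z by rewrite -(separated_disjoint sE).
have QP0 : closure Q `&` P = set0.
  apply/disjoints_subset; apply: subset_trans (closureS _) (open_closedC oP).
  by apply/disjoints_subset; rewrite setIC.
have PQ0' : closure P `&` Q = set0.
  apply/disjoints_subset; apply: subset_trans (closureS _) (open_closedC oQ).
  exact/disjoints_subset.
apply: (iffLR (connectedP _) coY
  (fun i => if i then E true else E false `|` Q)).
split.
- by case; [exact: E0|have [z] := E0 false; exists z; left].
- apply/seteqP; split=> // z _.
  have : (C `|` ~` C) z by rewrite setUCr.
  rewrite CPQ setUA EU.
  by move=> -[[Ez|Ez]|Qz]; [left; left|right|left; right].
- split.
    rewrite closureU setIUl sE.1 set0U -subset0 -QP0 => z [Qz Ez]; split => //.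
    exact: E1P.
  rewrite setIUl sE.2 set0U -subset0 -PQ0' => z [Qz Ez]; split => //.
  exact: closureS E1P _ Ez.
Qed.

Lemma separated_open (Y : topologicalType) (A B : set Y) :
  separated A B -> open (A `|` B) -> open A.
Proof.
move=> [_ AB0] oAB; have -> : A = (A `|` B) `&` ~` closure B.
  apply/seteqP; split=> [z Az|z [[//|Bz] nBz]]; last first.
    by exfalso; apply: nBz; exact: subset_closure.
  by split; [left|move=> Bz; have : set0 z by rewrite -AB0].
by apply: openI => //; exact/closed_openC/closed_closure.
Qed.

Lemma setU_part (T : Type) (C P Q : set T) :
  P `&` Q = set0 -> ~` C = P `|` Q -> C `|` P = ~` Q.
Proof.
move=> PQ0 CPQ; apply/seteqP; split=> z.
  move=> [Cz Qz|Pz Qz]; last by have : set0 z by rewrite -PQ0.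
  by have : (~` C) z by rewrite CPQ; right.
move=> nQz; have [Cz|nCz] := pselect (C z); first by left.
by have : (~` C) z by []; rewrite CPQ => -[?|//]; right.
Qed.

(** If [P] were divided into two parts, then adding to [C] the other side [Q]
    and the part that contains [p] would give a proper subcontinuum containing
    both [p] and [q]. *)
Lemma open_connected_side (Y : topologicalType) (p q : Y) (C P Q : set Y) :
  connected [set: Y] ->
  (forall D, closed D -> connected D -> D p -> D q -> D = [set: Y]) ->
  connected C -> open P -> open Q -> P `&` Q = set0 -> ~` C = P `|` Q ->
  P p -> Q q -> connected P.
Proof.
move=> coY pqY coC oP oQ PQ0 CPQ Pp Qq; apply: contrapT.
move=> /connectedPn[E [E0 EU sE]].
wlog Ep : E E0 EU sE / E false p.
  move=> IH; have : (E false `|` E true) p by rewrite -EU.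
  move=> [|Ep]; first exact: IH.
  apply: (IH (E \o negb)) => //=; first by rewrite EU setUC.
  by rewrite separatedC.
have oE0 : open (E false) by apply: separated_open sE _; rewrite -EU.
have oE1 : open (E true).
  move: sE; rewrite separatedC => sE; apply: separated_open sE _.
  by rewrite setUC -EU.
have EQ0 : (E false `|` Q) `&` E true = set0.
  rewrite setIUl (separated_disjoint sE) set0U -subset0 -PQ0 => z [Qz Ez].
  by split => //; rewrite EU; right.
have CE : ~` C = (E false `|` Q) `|` E true by rewrite CPQ EU setUAC.
have oEQ : open (E false `|` Q) by exact: openU.
have coD := connected_setU_part coY coC oEQ oE1 EQ0 CE.
have DE := setU_part EQ0 CE.
have DT : C `|` (E false `|` Q) = [set: Y].
  apply: pqY => //; first by rewrite DE; exact: open_closedC.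
    by right; left.
  by right; right.
have [z Ez] := E0 true.
have : (~` E true) z by rewrite -DE DT.
by apply.
Qed.

(** If the complement of [C] is not connected, then it has two open sides, and
    irreducibility between [p] and [q] forces each side to contain one of these
    points and to be connected. *)
Lemma irreducible_open_connected (Y : topologicalType) (C : set Y) :
  irreducible Y -> closed C -> connected C -> C <> [set: Y] ->
  exists P, [/\ open P, connected P, P !=set0 & P `&` C = set0].
Proof.
move=> irY clC coC CT; have [[_ _ coY] _] := irY.
have [p [q pqY]] := irreducible_between irY.
have oC : open (~` C) by exact: closed_openC.
have C0 := setC_neq0 CT.
have [coCC|/connectedPn[E [E0 EU sE]]] := pselect (connected (~` C)).
  by exists (~` C); split => //; rewrite setICl.
have oE0 : open (E false) by apply: separated_open sE _; rewrite -EU.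
have oE1 : open (E true).
  move: sE; rewrite separatedC => sE; apply: separated_open sE _.
  by rewrite setUC -EU.
have dis := separated_disjoint sE.
have EC b : E b `&` C = set0.
  rewrite -subset0 => z [Ez Cz]; have : (~` C) z; last by apply.
  by rewrite EU; case: b Ez => Ez; [right|left].
(* C together with one of the two sides is a proper subcontinuum *)
have side P Q : open P -> open Q -> P `&` Q = set0 -> ~` C = P `|` Q ->
    Q !=set0 -> ~ ((C `|` P) p /\ (C `|` P) q).
  move=> oP oQ PQ0 CPQ [z Qz] [CPp CPq].
  have CPE := setU_part PQ0 CPQ.
  have CPT : C `|` P = [set: Y].
    apply: pqY => //; first by rewrite CPE; exact: open_closedC.
    exact: connected_setU_part coY coC oP oQ PQ0 CPQ.
  by have : (~` Q) z by rewrite -CPE CPT.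
have EU' : ~` C = E true `|` E false by rewrite setUC.
have dis' : E true `&` E false = set0 by rewrite setIC.
have s0 := side _ _ oE0 oE1 dis EU (E0 true).
have s1 := side _ _ oE1 oE0 dis' EU' (E0 false).
have loc z : [\/ C z, E false z | E true z].
  have [Cz|nCz] := pselect (C z); first by constructor 1.
  have : (~` C) z by [].
  by rewrite EU => -[?|?]; [constructor 2|constructor 3].
have [Cp|Ep|Ep] := loc p; have [Cq|Eq|Eq] := loc q.
- by exfalso; apply: s0; split; left.
- by exfalso; apply: s0; split; [left|right].
- by exfalso; apply: s1; split; [left|right].
- by exfalso; apply: s0; split; [right|left].
- by exfalso; apply: s0; split; right.
- exists (E false); split => //.
  exact: open_connected_side coY pqY coC oE0 oE1 dis EU Ep Eq.
- by exfalso; apply: s1; split; [right|left].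
- exists (E true); split => //.
  exact: open_connected_side coY pqY coC oE1 oE0 dis' EU' Ep Eq.
- by exfalso; apply: s1; split; right.
Qed.

(** * From irreducible to indecomposable *)

(** A partition of the trace into relatively clopen [B] and [B'] extends to [P]:
    near a point [z] of [P], the sets [B] and [B'] are closed in [X] once
    intersected with a closed neighborhood of [z] inside [P], so [z] is not in
    the closure of both. Hence the closures of [B] and [B'] would partition
    [P]. *)
Lemma connected_trace (X K : topologicalType) (e : X -> K) (P : set K) :
  compactification e ->
  (forall A B : set X, closed A -> closed B -> A `&` B = set0 ->
    closure (e @` A) `&` closure (e @` B) = set0) ->
  open P -> connected P -> connected (e @^-1` P).
Proof.
move=> [cK hK ee de] disj oP coP B B0 [C oC BC] [D clD BD].
apply/seteqP; split=> [x|y Py]; first by rewrite BC => -[].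
apply: contrapT => nBy.
pose B' := (e @^-1` P) `\` B.
have B'C x : (e @^-1` P) x -> B' x = (~` C) x.
  move=> Px; rewrite /B' BC propeqE; split=> [[_ n] Cx|nC]; first by apply: n.
  by split => // -[].
have ce := embedding_continuous ee; move/continuous_closedP : (ce) => cle.
have apart z : P z -> closure (e @` B) z -> closure (e @` B') z -> False.
  move=> Pz Bz B'z.
  have [N [oN Nz NP]] := compact_shrink cK hK oP Pz.
  pose L := e @^-1` closure N.
  have clL : closed L by apply: cle; exact: closed_closure.
  have near_z A : closure (e @` A) z -> closure (e @` (A `&` L)) z.
    move=> Az M nM.
    have [_ [[a Aa <-] [Ma Na]]] :=
      Az _ (filterI nM (open_nbhs_nbhs (conj oN Nz))).
    exists (e a); split => //; exists a => //; split => //.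
    exact: subset_closure.
  have : set0 z; last by [].
  rewrite -(disj (B `&` L) (B' `&` L)).
  - by split; exact: near_z.
  - have -> : B `&` L = D `&` L.
      apply/seteqP; split=> t [Bt Lt]; split => //.
        by move: Bt; rewrite BD => -[].
      by rewrite BD; split => //; exact: NP.
    exact: closedI.
  - have -> : B' `&` L = ~` C `&` L.
      apply/seteqP; split=> t [Bt Lt]; split => //; move: Bt;
        by rewrite B'C//; exact: NP.
    by apply: closedI => //; exact: open_closedC.
  - by rewrite -subset0 => t [[Bt _] [[_ nBt] _]].
have cover : P `<=` closure (e @` B) `|` closure (e @` B').
  have clU : closed (closure (e @` B) `|` closure (e @` B')).
    by apply: closedU; exact: closed_closure.
  apply: subset_trans (dense_range_closure de oP) _.
  apply: subset_trans (closureS _) clU => _ [x Px <-].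
  by have [Bx|nBx] := pselect (B x); [left|right]; apply: subset_closure;
    exists x.
have PE : P `&` closure (e @` B) = P.
  apply: coP.
  - have [x Bx] := B0; exists (e x); split; last first.
      by apply: subset_closure; exists x.
    by move: Bx; rewrite BC => -[].
  - exists (~` closure (e @` B')); first exact/closed_openC/closed_closure.
    apply/seteqP; split=> z [Pz Bz]; split => //; first exact: apart.
    by have [] := cover _ Pz.
  - by exists (closure (e @` B)) => //; exact: closed_closure.
have : (P `&` closure (e @` B)) (e y) by rewrite PE.
move=> [_ Bey]; apply: (apart (e y)) => //.
by apply: subset_closure; exists y.
Qed.

Lemma irreducible_compactification_indecomposable (X K : topologicalType)
    (e : X -> K) :
  compactification e ->
  (forall A B : set X, closed A -> closed B -> A `&` B = set0 ->
    closure (e @` A) `&` closure (e @` B) = set0) ->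
  indecomposable X -> irreducible K -> indecomposable K.
Proof.
move=> ce disj indX irK; apply/indecomposableP => C clC coC CT.
have [cK hK ee de] := ce.
have [P [oP coP P0 PC0]] := irreducible_open_connected irK clC coC CT.
have oeP : open (e @^-1` P).
  by move/continuousP : (embedding_continuous ee); exact.
have [v [Pv [u _ uv]]] := de _ P0 oP.
have [dP|nd] := indX _ (connected_trace ce disj oP coP).
  apply: contrapT => /eqP/set0P C0.
  have [v' [Cv' [u' _ uv']]] := de _ C0 (open_interior C).
  have [||t [Ct Pt]] := dP (e @^-1` interior C).
  - by exists u'; rewrite /= uv'.
  - move/continuousP : (embedding_continuous ee); apply; exact: open_interior.
  by have : set0 (e t); [rewrite -PC0; split => //; exact: interior_subset|].
suff : interior (closure (e @^-1` P)) u by rewrite nd.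
rewrite /interior nbhsE; exists (e @^-1` P); last exact: subset_closure.
by split => //=; rewrite uv.
Qed.

(** * The equivalences *)

Theorem corollary10 (R : realType) (X : topologicalType)
    (X_separable : separable_space X) (X_metrizable : metrizable R X)
    (X_nondegenerate : exists x y : X, x <> y)
    (X_indecomposable : indecomposable X) (X_connected : connected [set: X]) :
  [<-> indecomposable (stone_cech R X);
       strongly_indecomposable X;
       exists (K : topologicalType) (e : X -> K),
         [/\ compactification e, metrizable R K & indecomposable K];
       exists (K : topologicalType) (e : X -> K),
         compactification e /\ indecomposable K;
       exists (K : topologicalType) (e : X -> K),
         compactification e /\ irreducible K;
       irreducible (stone_cech R X)].
Proof.
have nX := metrizable_normal X_metrizable.
have hX := metrizable_hausdorff X_metrizable.
have cX := stone_cech_embedding_compactification R nX hX.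
have [b bX] := separable_metrizable_base X_separable X_metrizable.
have sK := strongly_indecomposable_metrizable_compactification R nX hX bX.
tfae.
- exact: compactification_strongly_indecomposable cX.
- exact: sK.
- by move=> [K [e [ce _ iK]]]; exists K, e.
- move=> [K' [e' [ce' iK']]].
  have [K [e [ce mK iK]]] :=
    sK (compactification_strongly_indecomposable ce' iK').
  exists K, e; split => //.
  have [cK hK ee de] := ce.
  have [c bc] : exists c, @enumerated_base K c.
    apply: separable_metrizable_base mK.
    have [D cD dD] := X_separable; exists (e @` D).
      exact: card_le_trans (card_image_le _ _) cD.
    move=> O O0 oO; have [z [Oz [x _ xz]]] := de O O0 oO.
    have [||y [Oy Dy]] := dD (e @^-1` O).
    - by exists x; rewrite /= xz.
    - by move/continuousP : (embedding_continuous ee); exact.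
    by exists (e y); split => //; exists y.
  apply: (countable_base_irreducible _ bc) => //.
    by split=> //; exact: compactification_connected ce X_connected.
  have [x [y xy]] := X_nondegenerate.
  by exists (e x), (e y) => /ee.1.
- by move=> [K [e [ce iK]]]; apply: stone_cech_irreducible ce iK.
- apply: (irreducible_compactification_indecomposable cX) => //.
  by move=> A B clA clB AB0; exact: stone_cech_closures_disjoint.
Qed.
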